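(* Let $(a_n)_{n \ge 1}$ be a sequence of positive real numbers and, for $n \ge 2$, let $$u_n = \frac{\sqrt[n-1]{a_{n-1}}\,\sqrt[n+1]{a_{n+1}}}{\left(\sqrt[n]{a_n}\right)^{2}}.$$ Let $N \ge 2$ be an integer. Suppose $(s_n)$, $(S_n)$, $(f_n)$, $(g_n)$ are sequences of positive real numbers such that $s_n \le a_n \le S_n$ and $f_n \le a_{n+1}/a_n \le g_n$ for all $n \ge N-1$, and suppose $(\widetilde{f_n})$, $(\widetilde{g_n})$ are positive rational functions of $n$ such that for all $n \ge N$, $$(n^2 - n)\log f_{n} - (n^2 + n - 2)\log g_{n-1} + 2\log s_{n-1} > (n - 1)n(n + 1)\log \widetilde{f_{n}},$$ and $$(n^2 - n)\log g_{n} - (n^2 + n - 2)\log f_{n-1} + 2\log S_{n-1} < (n - 1)n(n + 1)\log \widetilde{g_{n}}.$$ Then $\widetilde{f_n} < u_n < \widetilde{g_n}$ for all $n \ge N$.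
   Context: Here $\log$ is the natural logarithm. *)

(* Defs.v *)
From mathcomp Require Import all_boot all_order all_algebra.
From mathcomp Require Import reals exp.

Set Implicit Arguments.
Unset Strict Implicit.
Unset Printing Implicit Defensive.

Import Order.TTheory GRing.Theory Num.Theory.
Local Open Scope ring_scope.

(* Real [k]-th root; used only for [1 <= k] and [0 < x]. *)
Definition rootr (R : realType) (k : nat) (x : R) : R := x `^ (k%:R^-1).

(* Used only for [2 <= n], so that [n.-1] is the true predecessor. *)
Definition root_ratio (R : realType) (a : nat -> R) (n : nat) : R :=
  (rootr n.-1 (a n.-1) * rootr n.+1 (a n.+1)) / (rootr n (a n)) ^+ 2.

(* From index [N] on, [h] is the restriction to the integers of a quotient of
   polynomials whose denominator does not vanish at these integers. *)
Definition rational_function_from (R : realType) (N : nat) (h : nat -> R) : Prop :=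
  exists p q : {poly R}, forall n : nat, (N <= n)%N ->
    q.[n%:R] != 0 /\ h n = p.[n%:R] / q.[n%:R].

(* Main.v *)
(* Writing L = ln a, the quantity (n-1) n (n+1) ln u_n equals
   (n^2-n)(L_(n+1)-L_n) - (n^2+n-2)(L_n-L_(n-1)) + 2 L_(n-1).  The coefficients
   n^2-n and n^2+n-2 are nonnegative, so the bounds on a_n and a_(n+1)/a_n
   enclose it, and ln is strictly increasing. *)
Require Import Defs.
From mathcomp Require Import all_boot all_order all_algebra.
From mathcomp Require Import reals exp.
From mathcomp Require Import ring lra.

Set Implicit Arguments.
Unset Strict Implicit.
Unset Printing Implicit Defensive.

Import Order.TTheory GRing.Theory Num.Theory.
Local Open Scope ring_scope.

Lemma root_ratio_gt0 (R : realType) (a : nat -> R) (n : nat) :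
  0 < a n.-1 -> 0 < a n -> 0 < a n.+1 -> 0 < root_ratio a n.
Proof.
move=> a0 a1 a2; rewrite /root_ratio /rootr.
by rewrite divr_gt0 ?mulr_gt0 ?exprn_gt0 ?powR_gt0.
Qed.

(** With L = [ln a], clearing denominators in L_(n-1)/(n-1) + L_(n+1)/(n+1) - 2 L_n/n gives (n^2+n)
    L_(n-1) + (n^2-n) L_(n+1) - 2(n^2-1) L_n; the right-hand side has the same coefficients. *)
Lemma ln_root_ratio (R : realType) (a : nat -> R) (n : nat) :
  (2 <= n)%N -> 0 < a n.-1 -> 0 < a n -> 0 < a n.+1 ->
  (n%:R - 1) * n%:R * (n%:R + 1) * ln (root_ratio a n) =
  (n%:R ^+ 2 - n%:R) * ln (a n.+1 / a n)
    - (n%:R ^+ 2 + n%:R - 2) * ln (a n / a n.-1) + 2 * ln (a n.-1).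
Proof.
case: n => [|[|m]] //= _ a0 a1 a2; rewrite /root_ratio /rootr /=.
rewrite ln_div ?posrE ?mulr_gt0 ?exprn_gt0 ?powR_gt0 //.
rewrite lnM ?posrE ?powR_gt0 // lnXn ?powR_gt0 // !ln_powR.
(* Express everything through x = n - 1 > 0: the root exponents become the inverses of x, x + 1 and
   x + 2, all defined. *)
rewrite !ln_div ?posrE // -[m.+3]addn1 -[m.+2]addn1 !natrD.
have : 0 < m.+1%:R :> R by rewrite ltr0n.
move: (m.+1%:R) => x x_gt0.
by field; rewrite !gt_eqF ?addr_gt0.
Qed.

Theorem theorem2p2 (R : realType) (a : nat -> R)
    (a_gt0 : forall n : nat, (1 <= n)%N -> 0 < a n)
    (N : nat) (N_ge2 : (2 <= N)%N)
    (s S f g : nat -> R)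
    (s_gt0 : forall n : nat, (N.-1 <= n)%N -> 0 < s n)
    (S_gt0 : forall n : nat, (N.-1 <= n)%N -> 0 < S n)
    (f_gt0 : forall n : nat, (N.-1 <= n)%N -> 0 < f n)
    (g_gt0 : forall n : nat, (N.-1 <= n)%N -> 0 < g n)
    (a_bounds : forall n : nat, (N.-1 <= n)%N -> s n <= a n /\ a n <= S n)
    (ratio_bounds : forall n : nat, (N.-1 <= n)%N ->
       f n <= a n.+1 / a n /\ a n.+1 / a n <= g n)
    (ft gt : nat -> R)
    (ft_rational : rational_function_from N ft)
    (gt_rational : rational_function_from N gt)
    (ft_gt0 : forall n : nat, (N <= n)%N -> 0 < ft n)
    (gt_gt0 : forall n : nat, (N <= n)%N -> 0 < gt n)
    (lower : forall n : nat, (N <= n)%N ->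
       (n%:R ^+ 2 - n%:R) * ln (f n) - (n%:R ^+ 2 + n%:R - 2) * ln (g n.-1)
         + 2 * ln (s n.-1)
       > (n%:R - 1) * n%:R * (n%:R + 1) * ln (ft n))
    (upper : forall n : nat, (N <= n)%N ->
       (n%:R ^+ 2 - n%:R) * ln (g n) - (n%:R ^+ 2 + n%:R - 2) * ln (f n.-1)
         + 2 * ln (S n.-1)
       < (n%:R - 1) * n%:R * (n%:R + 1) * ln (gt n)) :
  forall n : nat, (N <= n)%N -> ft n < root_ratio a n /\ root_ratio a n < gt n.
Proof.
move=> n Nn; have n_ge2 : (2 <= n)%N := leq_trans N_ge2 Nn.
have predn_gt0 : (0 < n.-1)%N by case: n n_ge2 {Nn} => [|[|]].
have prednK : n.-1.+1 = n by case: n n_ge2 {Nn predn_gt0}.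
have Nn1 : (N.-1 <= n)%N := leq_trans (leq_pred N) Nn.
(* The bounds start at [N.-1], so they apply at n - 1 even when n = N. *)
have N1n1 : (N.-1 <= n.-1)%N by rewrite -!subn1 leq_sub2r.
have [a0 a1 a2] : [/\ 0 < a n.-1, 0 < a n & 0 < a n.+1].
  by split; apply: a_gt0 => //; apply: leq_trans n_ge2.
have u_gt0 := root_ratio_gt0 a0 a1 a2.
have [sa aS] := a_bounds _ N1n1.
have [fX Xg] := ratio_bounds _ Nn1.
have [fY Yg] := ratio_bounds _ N1n1; rewrite prednK in fY Yg.
have ler_lnW (x y : R) : 0 < x -> x <= y -> ln x <= ln y.
  by move=> x0 xy; rewrite ler_ln ?posrE // (lt_le_trans x0).
have n2 : 2 <= n%:R :> R by rewrite ler_nat.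
have c1 : 0 <= n%:R ^+ 2 - n%:R :> R by nra.
(* Here n^2 + n - 2 = (n-1)(n+2). *)
have c2 : 0 <= n%:R ^+ 2 + n%:R - 2 :> R by nra.
have k_gt0 : 0 < (n%:R - 1) * n%:R * (n%:R + 1) :> R.
  by rewrite !mulr_gt0 //; lra.
have lnu := ln_root_ratio n_ge2 a0 a1 a2.
split.
(* Take logarithms and scale by (n-1) n (n+1) > 0 to reach the form of [lower]. The ratio at n - 1
   enters with a minus sign, so its upper bound [g n.-1] is the one used. *)
- rewrite -ltr_ln ?posrE ?ft_gt0 // -(ltr_pM2l k_gt0) lnu.
  apply: lt_le_trans (lower _ Nn) _.
  by rewrite lerD ?ler_wpM2l ?lerB ?ler_wpM2l ?ler_lnW ?divr_gt0 ?f_gt0 ?s_gt0.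
(* Symmetrically, the subtracted logarithm is bounded below through [f n.-1]. *)
- rewrite -ltr_ln ?posrE ?gt_gt0 // -(ltr_pM2l k_gt0) lnu.
  apply: le_lt_trans (upper _ Nn).
  by rewrite lerD ?ler_wpM2l ?lerB ?ler_wpM2l ?ler_lnW ?divr_gt0 ?f_gt0 ?s_gt0.
Qed.
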